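(* For all integers $n\ge 1$ and $k\ge 0$, $$|\mathcal{EM}(n,k)|=|\mathcal{OM}(n,k)|=|\mathcal{RM}(n,k)|.$$
   Context: All matrices are square (of dimension at least $1$) with nonnegative integer entries; the dimension of a matrix is its number of rows, rows and columns are numbered starting from $1$ (top to bottom, left to right), and $M_{i,j}$ is the entry in row $i$, column $j$. The size of a matrix is the sum of all its entries; the sum of a row (column) is the sum of the entries in it. A Fishburn matrix is an upper-triangular matrix of nonnegative integers in which every row and every column contains a nonzero entry. The dual $\overline{M}$ of a matrix $M$ of dimension $m$ is defined by $\overline{M}_{i,j}=M_{m+1-j,\,m+1-i}$ for $1\le i,j\le m$; $M$ is self-dual if $M=\overline{M}$. In a matrix of dimension $m$, a cell $(i,j)$ is a diagonal cell if $i+j=m+1$, an NW-cell if $i+j<m+1$, and an SE-cell if $i+j>m+1$. The reduced size of a self-dual Fishburn matrix is the sum of the entries in all its diagonal cells and NW-cells. $\mathcal{EM}(n,k)$ (resp. $\mathcal{OM}(n,k)$) is the set of self-dual Fishburn matrices of reduced size $n$ whose first row has sum $k$ and whose dimension is even (resp. odd). A row-Fishburn matrix is an upper-triangular matrix of nonnegative integers in which every row contains a nonzero entry. $\mathcal{RM}(n,k)$ is the set of row-Fishburn matrices of size $n$ whose last column has sum $k$. *)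

(* Defs.v *)
From HB Require Import structures.
From mathcomp Require Import all_boot all_order all_algebra.
From mathcomp Require Import boolp classical_sets functions cardinality.

Set Implicit Arguments.
Unset Strict Implicit.
Unset Printing Implicit Defensive.

Local Open Scope nat_scope.
Local Open Scope classical_set_scope.

(* Indices are 0-based: the cell in row i and column j, counted from 1, is the
   entry at the ordinals of value i - 1 and j - 1. *)

Definition sum_row (m : nat) (M : 'M[nat]_m) (i : 'I_m) : nat :=
  \sum_(j < m) M i j.

Definition sum_col (m : nat) (M : 'M[nat]_m) (j : 'I_m) : nat :=
  \sum_(i < m) M i j.

Definition msize (m : nat) (M : 'M[nat]_m) : nat :=
  \sum_(i < m) \sum_(j < m) M i j.

Definition upper_triangular (m : nat) (M : 'M[nat]_m) : Prop :=
  forall i j : 'I_m, j < i -> M i j = 0.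

Definition rows_nonzero (m : nat) (M : 'M[nat]_m) : Prop :=
  forall i : 'I_m, exists j : 'I_m, M i j <> 0.

Definition cols_nonzero (m : nat) (M : 'M[nat]_m) : Prop :=
  forall j : 'I_m, exists i : 'I_m, M i j <> 0.

Definition row_fishburn (m : nat) (M : 'M[nat]_m) : Prop :=
  upper_triangular M /\ rows_nonzero M.

Definition fishburn (m : nat) (M : 'M[nat]_m) : Prop :=
  [/\ upper_triangular M, rows_nonzero M & cols_nonzero M].

(* rev_ord turns the 1-based index j into m + 1 - j. *)
Definition dual (m : nat) (M : 'M[nat]_m) : 'M[nat]_m :=
  \matrix_(i < m, j < m) M (rev_ord j) (rev_ord i).

Definition self_dual (m : nat) (M : 'M[nat]_m) : Prop := M = dual M.

Definition diagonal_cell (m : nat) (i j : 'I_m) : bool :=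
  i.+1 + j.+1 == m.+1.

Definition NW_cell (m : nat) (i j : 'I_m) : bool :=
  i.+1 + j.+1 < m.+1.

Definition reduced_size (m : nat) (M : 'M[nat]_m) : nat :=
  \sum_(i < m) \sum_(j < m | diagonal_cell i j || NW_cell i j) M i j.

(* Square matrices of arbitrary dimension at least 1: the first component is
   the dimension minus 1. *)
Definition sqmatrix : Type := {m : nat & 'M[nat]_m.+1}.

Definition dimension (A : sqmatrix) : nat := (tag A).+1.

Definition SDF (n k : nat) : set sqmatrix :=
  [set A | [/\ fishburn (tagged A), self_dual (tagged A),
               reduced_size (tagged A) = n & sum_row (tagged A) ord0 = k]].

Definition EMset (n k : nat) : set sqmatrix :=
  [set A | SDF n k A /\ ~~ odd (dimension A)].

Definition OMset (n k : nat) : set sqmatrix :=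
  [set A | SDF n k A /\ odd (dimension A)].

Definition RMset (n k : nat) : set sqmatrix :=
  [set A | [/\ row_fishburn (tagged A), msize (tagged A) = n
             & sum_col (tagged A) ord_max = k]].

(* Main.v *)
Require Import Defs.
From mathcomp Require Import all_boot all_order all_algebra.
From mathcomp Require Import ring zify.
From mathcomp Require Import boolp classical_sets functions cardinality.

Set Implicit Arguments.
Unset Strict Implicit.
Unset Printing Implicit Defensive.

Import GRing.Theory.

(* A self-dual matrix of dimension m is determined by its NW and diagonal cells.
   There, the columns j < ceil(m/2) must be nonzero, the other columns are
   arbitrary, and each of the p = floor(m/2) "hooks" (the traces of the first p
   rows of the matrix) must be nonzero.  Let x mark the size, y the first row,
   and let b_c be the generating function of an arbitrary column with c cells.
   By inclusion-exclusion over the set S of hooks forced to vanish, with q rows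
   outside S, each column j < p contributes b_c - 1 and each j outside S also
   contributes b_c, where c counts the rows i <= j outside S.  At a fixed level c
   the alternating sum over the columns of S is geometric:
     b_c (b_c - 1) (1 - (b_c - 1) + (b_c - 1)^2 - ..) = b_c - 1,
   so the even dimensions add up to the sum over q of prod_(c <= q) (b_c - 1),
   which is the generating function of row-Fishburn matrices.  In odd dimension
   the middle column contributes the additional factor b_(q+1) - 1.  The geometric
   series is handled by telescoping, modulo x^(n+1). *)

(** * Signed sums over sets of hooks, and their telescoping *)

Section SignedSums.

Local Open Scope ring_scope.

Variables (R : comNzRingType) (x : R) (b : nat -> R).
Hypothesis (bx : forall c, exists r, b c = 1 + x * r).

(* [iter p step F 0] is the sum over the subsets S of {0, .., p-1}, with sign
   (-1)^|S|, of the product over the columns j of [b c_j - 1], times [F c_p],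
   where c_j is the number of rows i <= j outside S (see [sum_bitseqs]). *)
Definition step (F : nat -> R) (q : nat) : R :=
  (b q.+1 - 1) * F q.+1 - (b q - 1) * F q.

(** For [q = 0] and [b = column_gf], the generating function of row-Fishburn matrices of dimension
    [d] (see [row_gf]). *)
Definition rising (q d : nat) : R := \prod_(c < d) (b (q + c).+1 - 1).

(** With [q] rows outside S, the right-half columns give the product of the [b c]; [e] is the parity
    of the dimension, and [e = 1] adds the middle column. *)
Definition seed (e q : nat) : R := \prod_(c < q.+1) b c * rising q e.

(* Solves [G - step G = seed e] up to a multiple of [x ^+ M], so that the sum of
   the iterates of [step] on [seed e] telescopes. *)
Definition potential (e M q : nat) : R :=
  \prod_(c < q) b c * \sum_(e <= d < M) rising q d.

Lemma risingS q d : rising q d.+1 = (b q.+1 - 1) * rising q.+1 d.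
Proof.
rewrite /rising big_ord_recl addn0; congr (_ * _).
by apply: eq_bigr => i _; rewrite /= /bump /= add1n addnS addSn.
Qed.

(** Adding [G q] to the [(b q - 1) * G q] of [step] completes the product of the [b c]; by [risingS]
    both remaining terms share this product, and their sums over [d] differ by a shift. *)
Lemma potential_step e M q : (e <= M)%N ->
  potential e M q - step (potential e M) q = seed e q - seed M q.
Proof.
move=> eM.
have -> : potential e M q - step (potential e M) q =
    b q * potential e M q - (b q.+1 - 1) * potential e M q.+1.
  by rewrite /step; ring.
have tel : \sum_(e <= d < M) (rising q d.+1 - rising q d) =
    rising q M - rising q e by rewrite telescope_sumr.
have -> : (b q.+1 - 1) * potential e M q.+1 =
    \prod_(c < q.+1) b c * \sum_(e <= d < M) rising q d.+1.
  rewrite /potential mulrCA mulr_sumr; congr (_ * _).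
  by apply: eq_bigr => d _; rewrite risingS.
have -> : b q * potential e M q =
    \prod_(c < q.+1) b c * \sum_(e <= d < M) rising q d.
  by rewrite /potential big_ord_recr /= mulrA [b q * _]mulrC.
rewrite /seed -!mulrBr; congr (_ * _).
by rewrite -[RHS]opprB -tel sumrB opprB.
Qed.

Lemma iter_stepB p F G q :
  iter p step (fun i => F i - G i) q = iter p step F q - iter p step G q.
Proof. by elim: p q => //= p IH q; rewrite /step !IH; ring. Qed.

Lemma eq_iter_step p F G : F =1 G -> iter p step F =1 iter p step G.
Proof. by move=> FG; elim: p => //= p IH q; rewrite /step !IH. Qed.

(** Each [step] gains a factor [x], because [x] divides every [b c - 1]. *)
Lemma iter_step_dvd p k F : (forall q, exists r, F q = x ^+ k * r) ->
  forall q, exists r, iter p step F q = x ^+ (p + k) * r.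
Proof.
move=> Fx; elim: p => //= p IH q; rewrite /step.
have [r1 ->] := bx q.+1; have [r2 ->] := bx q.
have [s1 ->] := IH q.+1; have [s2 ->] := IH q.
by exists (r1 * s1 - r2 * s2); rewrite addSn exprS; ring.
Qed.

Lemma rising_dvd q d : exists r, rising q d = x ^+ d * r.
Proof.
elim: d => [|d [r IH]]; first by exists 1; rewrite /rising big_ord0 mulr1.
have [s bs] := bx (q + d).+1.
exists (r * s); rewrite /rising big_ord_recr /= -/(rising q d) IH bs exprS.
by ring.
Qed.

(** By [potential_step] the sum telescopes to [potential e M 0]. The boundary term has [x ^+ M] from
    [M] steps, the error from the [M] factors of [rising] in [seed M]. *)
Lemma sum_iter_step e M : (e <= M)%N -> exists r,
  \sum_(p < M) iter p step (seed e) 0 =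
  \sum_(e <= d < M) rising 0 d + x ^+ M * r.
Proof.
move=> eM.
have pot q : seed e q =
    (potential e M q - step (potential e M) q) - (0 - seed M q).
  by rewrite potential_step //; ring.
have tel K : \sum_(p < K) (iter p step (potential e M) 0
      - iter p step (step (potential e M)) 0) =
    potential e M 0 - iter K step (potential e M) 0.
  elim: K => [|K IH]; first by rewrite big_ord0 subrr.
  by rewrite big_ord_recr /= IH -iterSr /=; ring.
have errx q : exists r, 0 - seed M q = x ^+ M * r.
  have [r Er] := rising_dvd q M; rewrite /seed Er.
  by exists (- (\prod_(c < q.+1) b c * r)); ring.
have [r1 E1] : exists r,
    \sum_(p < M) iter p step (fun q => 0 - seed M q) 0 = x ^+ M * r.
  elim/big_rec: _ => [|i y _ [r ->]]; first by exists 0; rewrite mulr0.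
  have [s ->] := iter_step_dvd i errx 0.
  by exists (x ^+ i * s + r); rewrite exprD; ring.
have [r2 E2] : exists r, iter M step (potential e M) 0 = x ^+ M * r.
  have triv q : exists r, potential e M q = x ^+ 0 * r.
    by exists (potential e M q); rewrite mul1r.
  by have [s ->] := iter_step_dvd M triv 0; exists s; rewrite addn0.
exists (- r2 - r1).
pose err q := 0 - seed M q.
have split p : iter p step (seed e) 0 =
    iter p step (potential e M) 0 - iter p step (step (potential e M)) 0
    - iter p step err 0.
  by rewrite -!iter_stepB; apply: eq_iter_step => q; rewrite pot.
under eq_bigr do rewrite split.
by rewrite sumrB tel E2 /err E1 /potential big_ord0; ring.
Qed.

(* A bit sequence s encodes the subset [{i | nth false s i}]. *)
Fixpoint bitseqs (p : nat) : seq bitseq :=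
  if p is p'.+1 then [seq rcons s c | s <- bitseqs p', c <- [:: false; true]]
  else [:: [::]].

Lemma size_bitseqs p s : s \in bitseqs p -> size s = p.
Proof.
elim: p s => [s|p IH s]; first by rewrite inE => /eqP ->.
by case/allpairsP => -[t c] [/= /IH ts _ ->]; rewrite size_rcons ts.
Qed.

Lemma big_bitseqsS p (F : bitseq -> R) :
  \sum_(s <- bitseqs p.+1) F s =
  \sum_(s <- bitseqs p) (F (rcons s false) + F (rcons s true)).
Proof.
rewrite [LHS]big_allpairs_dep.
by apply: eq_bigr => s _; rewrite big_cons big_seq1.
Qed.

Definition zeros_upto (s : bitseq) (j : nat) : nat :=
  (\sum_(i < j) ~~ nth false s i)%N.

(** Inclusion-exclusion: with [h i] the indicator that hook [i] vanishes, the left side indicates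
    that no hook does. *)
Lemma prod1B_bitseqs p (h : nat -> R) :
  \prod_(i < p) (1 - h i) =
  \sum_(s <- bitseqs p) (\prod_(i < p) (-1) ^+ nth false s i) *
    \prod_(i < p) (if nth false s i then h i else 1).
Proof.
elim: p => [|p IH]; first by rewrite /= big_seq1 !big_ord0 mulr1.
rewrite big_ord_recr /= IH big_bitseqsS mulr_suml.
apply: eq_big_seq => s /size_bitseqs sp.
rewrite !big_ord_recr /= !nth_rcons sp ltnn eqxx.
have E c i : (i < p)%N -> nth false (rcons s c) i = nth false s i.
  by move=> ip; rewrite nth_rcons sp ip.
under [X in _ = X * _ * _ + _]eq_bigr do rewrite E //.
under [X in _ = _ * (X * _) + _]eq_bigr do rewrite E //.
under [X in _ = _ + X * _ * _]eq_bigr do rewrite E //.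
under [X in _ = _ + _ * (X * _)]eq_bigr do rewrite E //.
by rewrite expr0 expr1; ring.
Qed.

(** Splitting on the last bit gives the two terms of [step]: a zero bit raises the level by one, a
    one bit keeps it and brings the sign. *)
Lemma sum_bitseqs p F :
  \sum_(s <- bitseqs p) (\prod_(i < p) (-1) ^+ nth false s i) *
    (\prod_(j < p) (b (zeros_upto s j.+1) - 1)) * F (zeros_upto s p) =
  iter p step F 0.
Proof.
elim: p F => [|p IH] F.
  by rewrite /= big_seq1 [zeros_upto _ _]big_ord0 !big_ord0 !mul1r.
rewrite iterSr -IH big_bitseqsS; apply: eq_big_seq => s /size_bitseqs sp.
rewrite !big_ord_recr /= !nth_rcons sp ltnn eqxx.
have E c i : (i < p)%N -> nth false (rcons s c) i = nth false s i.
  by move=> ip; rewrite nth_rcons sp ip.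
have T c i : (i <= p)%N -> zeros_upto (rcons s c) i = zeros_upto s i.
  move=> ip; apply: eq_bigr => l _.
  by rewrite E // (leq_trans (ltn_ord l) ip).
have Tp c : zeros_upto (rcons s c) p.+1 = (zeros_upto s p + ~~ c)%N.
  rewrite -(T c p) // /zeros_upto big_ord_recr /=.
  by rewrite nth_rcons sp ltnn eqxx.
under [X in X * _ * _ * _ + _]eq_bigr do rewrite E //.
under [X in _ * (X * _) * _ + _]eq_bigr do rewrite T //.
under [X in _ + X * _ * _ * _]eq_bigr do rewrite E //.
under [X in _ + _ * (X * _) * _]eq_bigr do rewrite T //.
by rewrite !Tp /= addn0 addn1 /step expr0 expr1; ring.
Qed.

End SignedSums.

(** * Generating functions of fillings with bounded entries *)

Section Fillings.

Local Open Scope ring_scope.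

Variables (R : comNzRingType) (n : nat).

(** The series of [1 / (1 - t)] cut at degree [n]: stored entries that sum to [n] are at most [n],
    so finite types suffice. *)
Definition geom (t : R) : R := \sum_(e < n.+1) t ^+ e.

Definition line_ok (J : finType) (D : pred J) (nz : bool)
    (v : {ffun J -> 'I_n.+1}) : bool :=
  [forall j, (v j != ord0) ==> D j] && (nz ==> [exists j, v j != ord0]).

Definition filling (I J : finType) (D : I -> pred J) (nz : pred I)
    (f : {ffun I -> {ffun J -> 'I_n.+1}}) : bool :=
  [forall i, line_ok (D i) (nz i) (f i)].

Definition weight (I J : finType) (u : J -> R)
    (f : {ffun I -> {ffun J -> 'I_n.+1}}) : R :=
  \prod_i \prod_j u j ^+ f i j.

Lemma sum_supported_lines (J : finType) (D : pred J) (u : J -> R) :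
  \sum_(v : {ffun J -> 'I_n.+1} | [forall j, (v j != ord0) ==> D j])
    \prod_j u j ^+ v j = \prod_(j | D j) geom (u j).
Proof.
transitivity (\prod_j \sum_(e < n.+1 | (e != ord0) ==> D j) u j ^+ e).
  by rewrite bigA_distr_big_dep.
rewrite [RHS]big_mkcond; apply: eq_bigr => j _.
case: (D j); first by apply: eq_bigl => e; rewrite implybT.
under eq_bigl do rewrite implybF negbK.
by rewrite big_pred1_eq.
Qed.

(** Demanding a nonzero entry removes only the zero line, of weight 1. *)
Lemma sum_lines (J : finType) (D : pred J) (nz : bool) (u : J -> R) :
  \sum_(v | line_ok D nz v) \prod_j u j ^+ v j =
  \prod_(j | D j) geom (u j) - nz%:R.
Proof.
rewrite -sum_supported_lines; case: nz; last first.
  by rewrite subr0; apply: eq_bigl => v; rewrite /line_ok andbT.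
rewrite [in RHS](bigD1 [ffun=> ord0]) /=; last first.
  by apply/forallP => j; rewrite ffunE.
rewrite [X in _ = X + _ - _]big1 => [|j _]; last by rewrite ffunE.
rewrite /= mulr1n addrC addKr; apply: eq_bigl => v; rewrite /line_ok /=; congr (_ && _).
apply/existsP/negP => [[j vj] /eqP E|v0]; first by move: vj; rewrite E ffunE.
apply/existsP; rewrite -[[exists _, _]]negbK negb_exists; apply/negP => /forallP A.
by apply: v0; apply/eqP/ffunP => j; rewrite ffunE; apply/eqP; rewrite -[_ == _]negbK A.
Qed.

Lemma sum_fillings (I J : finType) (D : I -> pred J) (nz : pred I)
    (u : J -> R) :
  \sum_(f | filling D nz f) weight u f =
  \prod_i (\prod_(j | D i j) geom (u j) - (nz i)%:R).
Proof.
under [RHS]eq_bigr do rewrite -sum_lines.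
by rewrite bigA_distr_big_dep; apply: eq_bigl.
Qed.

End Fillings.

(** * Generating function of self-dual Fishburn matrices of a fixed dimension *)

Section SelfDual.

Local Open Scope ring_scope.

Variables (R : comNzRingType) (n : nat) (x y : R).

Definition var (j : nat) : R := if j is 0%N then x * y else x.

(* Generating function of an arbitrary column with [c] free cells, one of them in
   the first row. *)
Definition column_gf (c : nat) : R :=
  if c is c'.+1 then geom n (x * y) * geom n x ^+ c' else 1.

(** Column [j], row [i]. With 0-based indices, [i + j < m] covers NW-cells and diagonal cells. *)
Definition nw_region (m : nat) (j i : 'I_m) : bool :=
  (i <= j)%N && (i + j < m)%N.

(* Row [i] of a self-dual matrix consists of row [i] and the dual image of column
   [m.-1 - i] of its NW and diagonal part, on which [f] lives (column first). *)
Definition hook0 (m : nat) (f : {ffun 'I_m -> {ffun 'I_m -> 'I_n.+1}})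
    (i : nat) : bool :=
  [forall j : 'I_m, forall i' : 'I_m,
    ((i' == i :> nat) || (i + j == m.-1)%N) ==> (f j i' == ord0)].

Definition sd_code (m : nat) (f : {ffun 'I_m -> {ffun 'I_m -> 'I_n.+1}}) :=
  filling (@nw_region m) (fun j => (j < uphalf m)%N) f &&
  [forall i : 'I_m./2, ~~ hook0 f i].

(** The cell in row [i] and column [j] meets the hooks [i] and [m.-1 - j]; neither may be in the
    subset [s]. *)
Definition punctured_region (m : nat) (s : bitseq) (j i : 'I_m) : bool :=
  [&& nw_region j i, ~~ nth false s i & ~~ nth false s (m.-1 - j)].

Lemma punctured_filling m s (f : {ffun 'I_m -> {ffun 'I_m -> 'I_n.+1}}) :
  size s = m./2 ->
  filling (punctured_region s) (fun j => (j < uphalf m)%N) f =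
  filling (@nw_region m) (fun j => (j < uphalf m)%N) f &&
  [forall i : 'I_m./2, nth false s i ==> hook0 f i].
Proof.
(* Positions past the end of [s] read as [false], so a true bit always names a hook. *)
move=> sp; have s_lt i : nth false s i -> (i < m./2)%N.
  by move=> si; rewrite -sp ltnNge; apply/negP => /(nth_default false); rewrite si.
apply/forallP/andP => [A|[/forallP A /forallP B] j].
  split.
    apply/forallP => j; have /andP[/forallP S N] := A j.
    apply/andP; split=> //; apply/forallP => i; apply/implyP => fi.
    by have := S i; rewrite fi /= => /and3P[].
  apply/forallP => i; apply/implyP => si.
  apply/forallP => j; apply/forallP => i'; apply/implyP => H.
  have /andP[/forallP/(_ i') S _] := A j.
  apply: contraTT S => fi; rewrite negb_imply fi /=.
  rewrite /punctured_region !negb_and !negbK.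
  case/orP: H => [/eqP ->|/eqP H]; first by rewrite si orbT.
  have -> : (m.-1 - j = i)%N by lia.
  by rewrite si !orbT.
have /andP[/forallP S N] := A j.
apply/andP; split=> //; apply/forallP => i; apply/implyP => fi.
have := S i; rewrite fi /punctured_region /= => -> /=.
apply/andP; split; apply/negP => si.
  have := B (Ordinal (s_lt _ si)); rewrite si /= => /forallP/(_ j)/forallP/(_ i).
  by rewrite eqxx /= (negbTE fi).
have := B (Ordinal (s_lt _ si)); rewrite si /= => /forallP/(_ j)/forallP/(_ i).
have -> : (m.-1 - j + j == m.-1)%N by have := ltn_ord j; lia.
by rewrite orbT (negbTE fi).
Qed.

(** Each positive level is reached at exactly one column outside the subset; [b 0 = 1] supplies the
    index 0. *)
Lemma prod_zeros_upto (b : nat -> R) s p : b 0%N = 1 ->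
  \prod_(j < p) (if nth false s j then 1 else b (zeros_upto s j.+1)) =
  \prod_(c < (zeros_upto s p).+1) b c.
Proof.
move=> b0; elim: p => [|p IH].
  by rewrite [zeros_upto s 0]big_ord0 big_ord0 big_ord1.
have E : zeros_upto s p.+1 = (zeros_upto s p + ~~ nth false s p)%N.
  by rewrite /zeros_upto big_ord_recr.
rewrite big_ord_recr /= IH E; case: (nth false s p) => /=.
  by rewrite addn0 mulr1.
by rewrite addn1 [RHS]big_ord_recr.
Qed.

Lemma prod_var_zeros s j : nth false s 0 = false ->
  \prod_(i < j.+1 | ~~ nth false s i) geom n (var i) =
  column_gf (zeros_upto s j.+1).
Proof.
move=> s0; rewrite /zeros_upto big_ord_recl big_mkcond big_ord_recl /= s0 add1n /=.
congr (_ * _); elim: j => [|j IH]; first by rewrite !big_ord0.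
rewrite !big_ord_recr /= IH exprD /bump /= add1n.
by case: (nth _ _ _); rewrite /= ?expr0 ?expr1.
Qed.

Lemma punctured_gf m s : (0 < m)%N -> size s = m./2 ->
  \prod_(j < m) (\prod_(i < m | punctured_region s j i) geom n (var i)
    - (j < uphalf m)%:R) =
  (\prod_(j < m./2) (column_gf (zeros_upto s j.+1) - 1)) *
    seed column_gf (odd m) (zeros_upto s m./2).
Proof.
move=> m0 sp.
have s_ge i : (m./2 <= i)%N -> nth false s i = false.
  by move=> ip; rewrite nth_default // sp.
set h := uphalf m; set p := m./2 in s_ge sp *.
have mE : m = (h + p)%N by rewrite /h /p; lia.
pose beta j := \prod_(i < j.+1 | ~~ nth false s i) geom n (var i).
(* Here [m.-1 - j >= p], so the bit of the column is false and only the rows [i <= j] matter. *)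
have lower (j : 'I_m) : (j < h)%N ->
    \prod_(i < m | punctured_region s j i) geom n (var i) = beta j.
  move=> jh; rewrite /beta.
  rewrite (big_ord_widen_cond m (fun i => ~~ nth false s i)
             (fun i => geom n (var i))) //.
  apply: eq_bigl => i; rewrite /punctured_region /nw_region.
  rewrite (s_ge (m.-1 - j)%N); last by rewrite /h /p in jh *; lia.
  rewrite andbT; case: nth; rewrite /= ?andbF //= andbT.
  by rewrite /h in jh; apply/andP/idP; lia.
(* A right-half column has the height of its mirror image [m.-1 - j], and is emptied when that hook
   is in [s]. *)
have upper (j : 'I_m) : (h <= j)%N ->
    \prod_(i < m | punctured_region s j i) geom n (var i) =
    if nth false s (m.-1 - j) then 1 else beta (m.-1 - j)%N.
  move=> hj; rewrite /punctured_region; case: nth.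
    by rewrite big_pred0 // => i; rewrite !andbF.
  rewrite /beta.
  rewrite (big_ord_widen_cond m (fun i => ~~ nth false s i)
             (fun i => geom n (var i))); last by have := ltn_ord j; lia.
  apply: eq_bigl => i; rewrite /nw_region andbT.
  case: nth; rewrite /= ?andbF //= andbT.
  by move: hj (ltn_ord j); rewrite /h => hj jm; apply/andP/idP; lia.
have -> : \prod_(j < m) (\prod_(i < m | punctured_region s j i) geom n (var i)
      - (j < h)%:R) =
    \prod_(j < h) (beta j - 1) *
    \prod_(j < p) (if nth false s j then 1 else beta j).
  pose g j := if (j < h)%N then beta j - 1 else
    if nth false s (m.-1 - j) then 1 else beta (m.-1 - j)%N.
  transitivity (\prod_(0 <= j < m) g j).
    rewrite big_mkord; apply: eq_bigr => j _; rewrite /g.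
    by case: (ltnP j h) => jh; [rewrite lower | rewrite upper // subr0].
  rewrite (big_cat_nat (n := h)) /=; [|lia|lia]; congr (_ * _).
    by rewrite big_mkord; apply: eq_bigr => j _; rewrite /g ltn_ord.
  rewrite -[X in \prod_(X <= _ < _) _]add0n big_addn.
  have -> : (m - h = p)%N by lia.
  rewrite big_nat_rev big_mkord /=.
  apply: eq_bigr => j _; rewrite add0n /g.
  have jp := ltn_ord j.
  have -> : (p - j.+1 + h < h)%N = false by lia.
  by have -> : (m.-1 - (p - j.+1 + h) = j)%N by lia.
(* If row 0 vanishes, column 0 has no free cell but must be nonzero: both sides are 0. Otherwise the
   marked cell of [column_gf] is present. *)
case s0: (nth false s 0).
  have p0 : (0 < p)%N by rewrite lt0n; apply: contraTneq s0 => p0; rewrite s_ge ?p0.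
  have h0 : (0 < h)%N by rewrite /h; lia.
  rewrite (bigD1 (Ordinal h0)) //= /beta big_mkcond big_ord1 s0 subrr !mul0r.
  rewrite (bigD1 (Ordinal p0)) //= /zeros_upto big_ord1 s0 /=.
  by rewrite subrr !mul0r.
have betaE j : beta j = column_gf (zeros_upto s j.+1) by exact: prod_var_zeros.
under [X in X * _ = _]eq_bigr do rewrite betaE.
under [X in _ * X = _]eq_bigr do rewrite betaE.
rewrite prod_zeros_upto // /seed [RHS]mulrCA [LHS]mulrC; congr (_ * _).
have -> : h = (p + odd m)%N by rewrite /h /p; lia.
case: (odd m); last by rewrite addn0 /rising big_ord0 mulr1.
rewrite addn1 big_ord_recr /= /rising big_ord1 addn0; congr (_ * (column_gf _ - 1)).
by rewrite /zeros_upto big_ord_recr /= s_ge //= addn1.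
Qed.

Lemma sum_sd_code m : (0 < m)%N ->
  \sum_(f : {ffun 'I_m -> {ffun 'I_m -> 'I_n.+1}} | sd_code f)
    weight (fun i : 'I_m => var i) f =
  iter m./2 (step column_gf) (seed column_gf (odd m)) 0%N.
Proof.
move=> m0; rewrite -sum_bitseqs.
transitivity (\sum_(s <- bitseqs m./2)
  (\prod_(i < m./2) (-1) ^+ nth false s i) *
  \sum_(f : {ffun 'I_m -> {ffun 'I_m -> 'I_n.+1}} |
      filling (punctured_region s) (fun j => (j < uphalf m)%N) f)
    weight (fun i : 'I_m => var i) f); last first.
  apply: eq_big_seq => s /size_bitseqs sp.
  by rewrite sum_fillings punctured_gf // mulrA.
under [RHS]eq_bigr do rewrite [X in _ * X]big_mkcond mulr_sumr.
rewrite exchange_big /= big_mkcond /=; apply: eq_bigr => f _.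
(* For a fixed filling, the signed sum over [s] is the indicator that no hook vanishes. *)
transitivity (if filling (@nw_region m) (fun j => (j < uphalf m)%N) f
  then \prod_(i < m./2) (1 - (hook0 f i)%:R) * weight (fun i : 'I_m => var i) f
  else 0).
  rewrite /sd_code; case: filling => //=.
  case: forallP => [A|/forallP].
    by rewrite big1 ?mul1r // => i _; rewrite (negbTE (A i)) subr0.
  rewrite negb_forall => /existsP[i]; rewrite negbK => hi.
  by rewrite (bigD1 i) //= hi subrr !mul0r.
rewrite (prod1B_bitseqs m./2 (fun i => (hook0 f i)%:R)).
case F: filling; last first.
  rewrite big_seq big1 // => s /size_bitseqs sp.
  by rewrite punctured_filling // F mulr0.
rewrite mulr_suml; apply: eq_big_seq => s /size_bitseqs sp.
rewrite punctured_filling // F /= -mulrA; congr (_ * _).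
case: forallP => [A|/forallP].
  rewrite big1 ?mul1r // => i _; have := A i.
  by case: nth => //= ->.
rewrite negb_forall => /existsP[i]; rewrite negb_imply => /andP[si hi].
by rewrite (bigD1 i) //= si (negbTE hi) !mul0r.
Qed.

End SelfDual.

(** * Row-Fishburn generating function and coefficient extraction *)

Section Counting.

Local Open Scope ring_scope.

Variable n : nat.

(** Reversing the columns puts the marked one first; reversing the rows makes their numbers of free
    cells 1, .., [m]. *)
Lemma row_gf (R : comNzRingType) (x y : R) m :
  \sum_(f : {ffun 'I_m -> {ffun 'I_m -> 'I_n.+1}} |
      filling (fun i j : 'I_m => (i <= j)%N) xpredT f)
    weight (fun j : 'I_m => var x y (rev_ord j)) f =
  rising (column_gf n x y) 0 m.
Proof.
rewrite sum_fillings /rising (reindex_inj rev_ord_inj).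
apply: eq_bigr => i _; rewrite add0n; congr (_ - _).
(* The empty sequence encodes the empty subset, so [prod_var_zeros] applies with no row removed. *)
have <- : zeros_upto [::] i.+1 = i.+1.
  rewrite /zeros_upto (eq_bigr (fun=> 1%N)) => [|j _]; last by rewrite nth_nil.
  by rewrite sum1_card card_ord.
rewrite -prod_var_zeros ?nth_nil // (reindex_inj rev_ord_inj) /=.
rewrite (big_ord_widen_cond m (fun j => ~~ nth false [::] j)
           (fun j => geom n (var x y j))) //.
apply: eq_big => [j|j _].
  by rewrite nth_nil /=; have := ltn_ord j; have := ltn_ord i; lia.
by congr (geom _ (var _ _ _)); have := ltn_ord j; lia.
Qed.

Lemma column_gf_1 (R : comNzRingType) (x y : R) c :
  exists r, column_gf n x y c = 1 + x * r.
Proof.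
have geom1 t : exists r, geom n (x * t) = 1 + x * r.
  exists (t * \sum_(i < n) (x * t) ^+ i).
  rewrite /geom big_ord_recl expr0 mulrA mulr_sumr; congr (_ + _).
  by apply: eq_bigr => i _; rewrite -exprS.
case: c => [|c] /=; first by exists 0; rewrite mulr0 addr0.
have [r ->] := geom1 y.
have [s ->] : exists s, geom n x ^+ c = 1 + x * s.
  elim: c => [|c [s IH]]; first by exists 0; rewrite mulr0 addr0.
  have [t E] := geom1 1; rewrite mulr1 in E.
  by exists (t + s + x * (t * s)); rewrite exprS IH E; ring.
by exists (r + s + x * (r * s)); ring.
Qed.

Definition entry_sum (I J : finType) (f : {ffun I -> {ffun J -> 'I_n.+1}}) : nat :=
  (\sum_i \sum_j f i j)%N.

Definition marked_sum (I J : finType) (j : J)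
    (f : {ffun I -> {ffun J -> 'I_n.+1}}) : nat := (\sum_i f i j)%N.

(** The outer variable records the total of the entries, the inner one the entries at [j0]. *)
Lemma coef_sum_weight (I J : finType) (j0 : J)
    (P : pred {ffun I -> {ffun J -> 'I_n.+1}}) (u : J -> {poly {poly int}}) a k :
  (forall j, u j = if j == j0 then 'X * 'X%:P else 'X) ->
  (\sum_(f | P f) weight u f)`_a`_k =
  #|[pred f | [&& P f, entry_sum f == a & marked_sum j0 f == k]]|%:R.
Proof.
move=> uE.
have wE f : weight u f = 'X^(entry_sum f) * ('X^(marked_sum j0 f))%:P.
  rewrite /weight /entry_sum /marked_sum -!prodrXr rmorph_prod -big_split /=.
  apply: eq_bigr => i _; rewrite -prodrXr (bigD1 j0) //= [in RHS](bigD1 j0) //=.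
  rewrite uE eqxx exprMn -rmorphXn -!mulrA; congr (_ * _).
  rewrite mulrC; congr (_ * _); apply: eq_bigr => j /negbTE jj.
  by rewrite uE jj.
rewrite !coef_sum -sum1_card natr_sum.
rewrite big_mkcond [RHS]big_mkcond; apply: eq_bigr => f _.
rewrite inE /=; case: (P f) => //=.
rewrite wE coefMC coefXn; case: (entry_sum f =P a) => [->|/eqP E] /=.
  by rewrite eqxx mul1r coefXn eq_sym; case: eqP.
by rewrite eq_sym (negbTE E) mul0r coef0.
Qed.

End Counting.

(** * From finite codes to cardinalities of sets of matrices *)

Local Open Scope nat_scope.
Local Open Scope card_scope.

Lemma card_imset_finType (T : finType) (U : Type) (P : pred T) (g : T -> U)
    (A : set U) :
  {in P &, injective g} -> (forall y, A y <-> exists2 t, P t & g t = y) ->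
  A #= `I_#|P|.
Proof.
move=> g_inj AE.
pose h (i : 'I_#|P|) := g (enum_val i).
have h_inj : {in [set: 'I_#|P|]%classic &, injective h}.
  by move=> i j _ _ /g_inj E; apply: enum_val_inj; apply: E; apply: enum_valP.
have -> : A = (h @` [set: 'I_#|P|])%classic.
  apply/seteqP; split=> y /=.
    case/AE => t Pt <-; exists (enum_rank_in (Pt : t \in P) t) => //.
    by rewrite /h enum_rankK_in.
  by case=> i _ <-; apply/AE; exists (enum_val i) => //; apply: (enum_valP i).
by rewrite (card_eql (inj_card_eq h_inj)) card_eq_sym card_II.
Qed.

(** [dm] lists the admissible values of the dimension minus 1, and [K] bounds how many of them
    occur. *)
Lemma card_sqmatrix_set (K : nat) (dm : nat -> nat) (C : nat -> finType)
    (P : forall m, pred (C m)) (mat : forall m, C m -> 'M[nat]_m.+1)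
    (A : set sqmatrix) :
  injective dm -> (forall m, {in @P m &, injective (@mat m)}) ->
  (forall B, A B <-> exists2 p : 'I_K, dm p = tag B &
     exists2 f, P (tag B) f & mat _ f = tagged B) ->
  A #= `I_(\sum_(p < K) #|P (dm p)|).
Proof.
move=> dm_inj mat_inj AE.
pose T := {p : 'I_K & C (dm p)}.
pose Q : pred T := fun t => P _ (tagged t).
pose g (t : T) : sqmatrix := existT _ (dm (tag t)) (mat _ (tagged t)).
have -> : \sum_(p < K) #|P (dm p)| = #|Q|.
  rewrite -sum1_card.
  transitivity (\sum_(p < K) \sum_(f | P (dm p) f) 1).
    by apply: eq_bigr => p _; rewrite sum1_card.
  by rewrite sig_big_dep.
apply: (@card_imset_finType _ _ Q g).
  move=> [p f] [q f'] Pf Pf' E.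
  have pq : p = q by apply/val_inj/dm_inj; exact: (congr1 tag E).
  subst q; congr existT; apply: (mat_inj _ _ _ Pf Pf').
  by move: E; rewrite /g /= => /eqP; rewrite -tag_eqE /tag_eq eqxx tagged_asE => /eqP.
move=> [m M]; split=> [/AE /= [p dmp [f Pf fM]]|[[p f] Pf gM]].
  by subst m; exists (existT _ p f); rewrite // /g /= fM.
by rewrite -gM; apply/AE => /=; exists p => //; exists f.
Qed.

(** * Matrices encoded by fillings *)

Section Encoding.
Variable n : nat.

Local Notation fills m := {ffun 'I_m -> {ffun 'I_m -> 'I_n.+1}}.

Definition row_mat (m : nat) (f : fills m) : 'M[nat]_m := \matrix_(i, j) (f i j : nat).

(** An SE-cell copies its dual cell; the swapped arguments reflect that [f] is stored column
    first. *)
Definition sd_mat (m : nat) (f : fills m) : 'M[nat]_m :=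
  \matrix_(i, j) (if i + j < m then f j i : nat else f (rev_ord i) (rev_ord j)).

Lemma sd_mat_self_dual m (f : fills m) : self_dual (sd_mat f).
Proof.
apply/matrixP => i j; rewrite !mxE !rev_ordK /=.
have im := ltn_ord i; have jm := ltn_ord j.
case: ltnP => ij; case: ltnP => ji //; last by lia.
by congr (val (f _ _)); apply: val_inj => /=; lia.
Qed.

Lemma self_dualE m (M : 'M[nat]_m) i j :
  self_dual M -> M (rev_ord j) (rev_ord i) = M i j.
Proof. by move=> E; rewrite [in RHS]E mxE. Qed.

Definition nw_supported m (f : fills m) : Prop :=
  forall j i, f j i != ord0 -> nw_region j i.

Lemma sd_mat_triangular m (f : fills m) :
  nw_supported f -> upper_triangular (sd_mat f).
Proof.
move=> fS i j ji; rewrite mxE; have im := ltn_ord i; have jm := ltn_ord j.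
case: ltnP => ij; apply/eqP; apply: contraT => /fS /andP[/=]; lia.
Qed.

Lemma sd_mat_row m (f : fills m) (i : 'I_m) : nw_supported f ->
  (exists j, sd_mat f i j <> 0) <-> ~~ hook0 f i.
Proof.
move=> fS; have im := ltn_ord i; split.
  move=> [j]; rewrite mxE; have jm := ltn_ord j.
  case: ltnP => ij fij; apply/negP => /forallP H.
    have /forallP/(_ i) := H j; rewrite eqxx /= => /eqP E.
    by rewrite E in fij.
  have /forallP/(_ (rev_ord j)) := H (rev_ord i).
  have -> : i + rev_ord i == m.-1 by rewrite /=; lia.
  by rewrite orbT /= => /eqP E; rewrite E in fij.
rewrite negb_forall => /existsP[j]; rewrite negb_forall => /existsP[i'].
rewrite negb_imply => /andP[H fji]; have /andP[/= ij ijm] := fS _ _ fji.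
have jm := ltn_ord j.
case/orP: H => [/eqP ii|/eqP ii].
  exists j; rewrite mxE -ii ijm; apply/eqP.
  by have <- : i' = i by apply: val_inj.
have jE : j = rev_ord i by apply: val_inj; rewrite /=; lia.
exists (rev_ord i'); rewrite mxE rev_ordK -jE; apply/eqP.
case: ltnP => //= A.
have -> : rev_ord i' = j by apply: val_inj; rewrite /=; lia.
by have -> : i = i' by apply: val_inj; rewrite /= in A *; lia.
Qed.

(** An SE-cell of such a column lies below the main diagonal, so [f j] holds every nonzero entry. *)
Lemma sd_mat_col m (f : fills m) (j : 'I_m) : nw_supported f ->
  j < uphalf m ->
  (exists i, sd_mat f i j <> 0) <-> [exists i, f j i != ord0].
Proof.
move=> fS jh; split.
  move=> [i]; rewrite mxE; case: ltnP => ij fij; apply/existsP.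
    by exists i; apply/eqP => E; rewrite E in fij.
  have /fS/andP[/=] : f (rev_ord i) (rev_ord j) != ord0.
    by apply/eqP => E; rewrite E in fij.
  by have := ltn_ord i; lia.
case/existsP => i fji; have /andP[/= ij ijm] := fS _ _ fji.
by exists i; rewrite mxE ijm; apply/eqP.
Qed.

(** Duality turns the conditions on the first [uphalf m] columns into those on the last rows; hooks
    give the first [m./2] rows, and duality again gives all columns. *)
Lemma sd_codeP m (f : fills m) :
  sd_code f <-> nw_supported f /\ fishburn (sd_mat f).
Proof.
split.
  case/andP => /forallP fF /forallP fH.
  have fS : nw_supported f.
    by move=> j i fji; have /andP[/forallP/(_ i)] := fF j; rewrite fji.
  have sd := sd_mat_self_dual f.
  have colP (j : 'I_m) : j < uphalf m -> exists i, sd_mat f i j <> 0.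
    move=> jh; apply/sd_mat_col => //.
    by have /andP[_] := fF j; rewrite jh.
  have rowP i : exists j, sd_mat f i j <> 0.
    case: (ltnP i m./2) => im.
      by apply/sd_mat_row => //; exact: (fH (Ordinal im)).
    have [|j] := colP (rev_ord i); first by rewrite /=; have := ltn_ord i; lia.
    by rewrite -self_dualE // rev_ordK => H; exists (rev_ord j).
  split=> //; split=> //; first exact: sd_mat_triangular.
  move=> j; have [i] := rowP (rev_ord j).
  by rewrite -self_dualE // rev_ordK => H; exists (rev_ord i).
case=> fS [_ rowP colP]; apply/andP; split.
  apply/forallP => j; apply/andP; split.
    by apply/forallP => i; apply/implyP/fS.
  by apply/implyP => jh; apply/sd_mat_col.
apply/forallP => i; have im : i < m by have := ltn_ord i; lia.
by apply/(sd_mat_row (Ordinal im)).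
Qed.

Lemma reduced_size_sd_mat m (f : fills m) :
  nw_supported f -> reduced_size (sd_mat f) = entry_sum f.
Proof.
move=> fS; rewrite /reduced_size /entry_sum [RHS]exchange_big.
apply: eq_bigr => i _; rewrite big_mkcond; apply: eq_bigr => j _.
have -> : diagonal_cell i j || NW_cell i j = (i + j < m).
  by rewrite /diagonal_cell /NW_cell; apply/orP/idP; lia.
rewrite mxE; case: ltnP => ij //.
have [fji|/fS/andP[_]] := eqVneq (f j i) ord0; first by rewrite fji.
by rewrite /=; lia.
Qed.

Lemma sum_row_sd_mat m (f : fills m.+1) :
  sum_row (sd_mat f) ord0 = marked_sum ord0 f.
Proof. by apply: eq_bigr => j _; rewrite mxE add0n ltn_ord. Qed.

Lemma sd_mat_surj m (M : 'M[nat]_m) :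
  upper_triangular M -> self_dual M -> reduced_size M = n ->
  exists2 f : fills m, nw_supported f & sd_mat f = M.
Proof.
move=> tri sd rs.
have Mn (i j : 'I_m) : i + j < m -> M i j < n.+1.
  move=> ij; rewrite ltnS -rs /reduced_size (bigD1 i) //=.
  rewrite (bigD1 j) /=; last by rewrite /diagonal_cell /NW_cell; apply/orP; lia.
  by rewrite -addnA leq_addr.
exists [ffun j : 'I_m => [ffun i : 'I_m => if i + j < m then inord (M i j) else ord0]].
  move=> j i; rewrite !ffunE; case: ltnP => ij; last by rewrite eqxx.
  move=> Mij; apply/andP; split=> //; rewrite leqNgt; apply/negP => ji.
  by move/eqP: Mij; apply; apply: val_inj; rewrite /= inordK ?Mn // tri.
apply/matrixP => i j; rewrite !mxE !ffunE.
have im := ltn_ord i; have jm := ltn_ord j.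
case: ifP => ij; first by rewrite ij inordK ?Mn.
have : rev_ord j + rev_ord i < m by rewrite /=; lia.
by move=> ji; rewrite ji inordK ?Mn ?self_dualE //.
Qed.

Lemma sd_mat_inj m (f g : fills m) :
  nw_supported f -> nw_supported g -> sd_mat f = sd_mat g -> f = g.
Proof.
move=> fS gS /matrixP E.
apply/ffunP => j; apply/ffunP => i; apply: val_inj.
have := E i j; rewrite !mxE; case: ltnP => // ij _.
have f0 : f j i = ord0.
  by apply/eqP; apply: contraT => /fS /andP[_ /=]; lia.
have g0 : g j i = ord0.
  by apply/eqP; apply: contraT => /gS /andP[_ /=]; lia.
by rewrite f0 g0.
Qed.

Definition sd_codes k m : pred (fills m.+1) :=
  [pred f | [&& sd_code f, entry_sum f == n & marked_sum ord0 f == k]].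

Lemma SDF_codes k (B : sqmatrix) :
  SDF n k B <-> exists2 f, sd_codes k f & sd_mat f = tagged B.
Proof.
case: B => m M; split=> /=.
  move=> [/= Mf sd rs row1]; have [tri _ _] := Mf.
  have [f fS fM] := sd_mat_surj tri sd rs.
  exists f => //; apply/and3P; rewrite -fM in Mf rs row1; split.
  - exact/sd_codeP.
  - by rewrite -reduced_size_sd_mat // rs.
  - by rewrite -sum_row_sd_mat row1.
move=> [f /and3P[/sd_codeP[fS Ff] /eqP fn /eqP fk] fM].
split; rewrite /= -fM //; first exact: sd_mat_self_dual.
  by rewrite reduced_size_sd_mat.
by rewrite sum_row_sd_mat.
Qed.

Lemma sd_codes_inj k m : {in @sd_codes k m &, injective (@sd_mat m.+1)}.
Proof.
move=> f g /and3P[/sd_codeP[fS _] _ _] /and3P[/sd_codeP[gS _] _ _].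
exact: sd_mat_inj.
Qed.

(** Each of the first [uphalf] columns contributes at least 1 to the reduced size. *)
Lemma sd_dimension k (B : sqmatrix) : SDF n k B -> uphalf (dimension B) <= n.
Proof.
case/SDF_codes => f /and3P[/andP[/forallP fF _] /eqP fn _] _.
rewrite /dimension -[X in X <= _]card_ord -sum1_card -[X in _ <= X]fn.
rewrite /entry_sum (big_ord_widen (tag B).+1 (fun=> 1)); last by lia.
rewrite big_mkcond; apply: leq_sum => j _; case: ifP => // jh.
have /andP[_] := fF j; rewrite jh => /existsP[i fji].
by rewrite (bigD1 i) //= ltn_addr // lt0n.
Qed.

Definition row_codes k m : pred (fills m.+1) :=
  [pred f | [&& filling (fun i j : 'I_m.+1 => (i <= j)) xpredT f,
     entry_sum f == n & marked_sum ord_max f == k]].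

Lemma RM_codes k (B : sqmatrix) :
  RMset n k B <-> exists2 f, row_codes k f & row_mat f = tagged B.
Proof.
case: B => m M; split=> /=.
  move=> [/= [tri rowP] sz col].
  have Mn i j : M i j < n.+1.
    by rewrite ltnS -sz /msize (bigD1 i) //= (bigD1 j) //= -addnA leq_addr.
  pose f : fills m.+1 := [ffun i => [ffun j => inord (M i j)]].
  have fE i j : f i j = M i j :> nat by rewrite !ffunE inordK.
  exists f; last by apply/matrixP => i j; rewrite mxE fE.
  apply/and3P; split.
  - apply/forallP => i; apply/andP; split.
      apply/forallP => j; apply/implyP => fij; rewrite leqNgt; apply/negP => ji.
      by move/eqP: fij; apply; apply: val_inj; rewrite [LHS]fE tri.
    have [j Mij] := rowP i; apply/existsP; exists j; apply/eqP => fij.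
    by apply: Mij; rewrite -fE fij.
  - apply/eqP; rewrite -[RHS]sz.
    by apply: eq_bigr => i _; apply: eq_bigr => j _; exact: fE.
  - by apply/eqP; rewrite -[RHS]col; apply: eq_bigr => i _; exact: fE.
move=> [f /and3P[/forallP fF /eqP fn /eqP fk] <-].
split; rewrite /=.
- split=> [i j ji|i].
    rewrite mxE; apply/eqP; apply: contraT => fij.
    have /andP[/forallP/(_ j)] := fF i.
    by rewrite leqNgt ji implybF negbK => /eqP E; rewrite E in fij.
  have /andP[_ /existsP[j fij]] := fF i.
  by exists j; rewrite mxE; apply/eqP.
- rewrite -fn; apply: eq_bigr => i _; apply: eq_bigr => j _; exact: mxE.
- rewrite -fk; apply: eq_bigr => i _; exact: mxE.
Qed.

Lemma row_codes_inj k m : {in @row_codes k m &, injective (@row_mat m.+1)}.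
Proof.
move=> f g _ _ /matrixP E; apply/ffunP => i; apply/ffunP => j.
by apply: val_inj; have := E i j; rewrite !mxE.
Qed.

Lemma row_dimension k (B : sqmatrix) : RMset n k B -> dimension B <= n.
Proof.
case: B => m M [/= [tri rowP] sz _]; rewrite -sz /dimension /=.
rewrite -[X in X <= _]card_ord -sum1_card /msize; apply: leq_sum => i _.
have [j Mij] := rowP i; rewrite (bigD1 j) //=.
by rewrite ltn_addr // lt0n; apply/eqP.
Qed.

End Encoding.

(** * Equality of the code counts *)

Section Counts.
Variables (n k : nat).

Local Open Scope ring_scope.

Let X : {poly {poly int}} := 'X.
Let Y : {poly {poly int}} := 'X%:P.
Let b := column_gf n X Y.

Lemma card_sd_codes m : (#|@sd_codes n k m|)%:R =
  (iter m.+1./2 (step b) (seed b (odd m.+1)) 0%N)`_n`_k.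
Proof.
rewrite -sum_sd_code // (coef_sum_weight (j0 := ord0)) // => j.
by rewrite /var -val_eqE /= -/Y; case: (val j).
Qed.

Lemma card_row_codes m : (#|@row_codes n k m|)%:R = (rising b 0 m.+1)`_n`_k.
Proof.
rewrite -row_gf (coef_sum_weight (j0 := ord_max)) // => j.
have -> : (j == ord_max) = (rev_ord j == 0%N :> nat).
  by rewrite -val_eqE /=; have := ltn_ord j; lia.
by rewrite /var; case: (val (rev_ord j)).
Qed.

Lemma coef_sum_iter_step (e : nat) : (e <= n.+1)%N ->
  (\sum_(p < n.+1) iter p (step b) (seed b e) 0%N)`_n`_k =
  (\sum_(e <= d < n.+1) rising b 0 d)`_n`_k.
Proof.
move=> en; have [r ->] := sum_iter_step (column_gf_1 n X Y) en.
(* The error is a multiple of [X ^+ n.+1], so it misses degree [n]. *)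
by rewrite coefD coefXnM ltnSn addr0.
Qed.

Lemma sum_row_codes :
  (\sum_(d < n) #|@row_codes n k d|)%:R =
  (\sum_(1 <= d < n.+1) rising b 0 d)`_n`_k.
Proof.
rewrite natr_sum big_add1 big_mkord !coef_sum.
by apply: eq_bigr => d _; rewrite card_row_codes.
Qed.

Lemma sum_odd_codes :
  (\sum_(p < n.+1) #|@sd_codes n k p.*2|)%:R =
  (\sum_(1 <= d < n.+1) rising b 0 d)`_n`_k.
Proof.
rewrite -coef_sum_iter_step // natr_sum !coef_sum; apply: eq_bigr => p _.
by rewrite card_sd_codes /= odd_double uphalf_double.
Qed.

Lemma sum_even_codes :
  (\sum_(p < n) #|@sd_codes n k p.*2.+1|)%:R =
  (\sum_(1 <= d < n.+1) rising b 0 d)`_n`_k.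
Proof.
have := coef_sum_iter_step (leq0n n.+1).
(* The terms [p = 0] and [d = 0] belong to dimension 0; both equal 1, as [b 0] does, and cancel. *)
rewrite big_ord_recl /= {1}/seed big_ord1 {1}/rising big_ord0 mulr1.
rewrite [in RHS]big_ltn // {1}/rising big_ord0 !coefD => /addrI <-.
rewrite natr_sum !coef_sum; apply: eq_bigr => p _.
by rewrite card_sd_codes /= odd_double /= doubleK.
Qed.

End Counts.

(** * Cardinalities of the three sets *)

Unset Implicit Arguments.

Theorem mainTheorem1 (n k : nat) (hn : 1 <= n) :
  EMset n k #= OMset n k /\ OMset n k #= RMset n k.
Proof.
(* The tag is the dimension minus 1, so even dimensions have odd tags. *)
have EMc : EMset n k #= `I_(\sum_(p < n) #|@sd_codes n k p.*2.+1|).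
  apply: (card_sqmatrix_set (dm := fun p => p.*2.+1) (P := @sd_codes n k)
    (mat := fun m => @sd_mat n m.+1)).
  - by move=> p q [] /double_inj.
  - by move=> m; exact: sd_codes_inj.
  move=> B; rewrite /EMset /=; split.
    move=> [SB eB]; have dB := sd_dimension SB.
    have pn : (tag B)./2 < n by rewrite /dimension in dB eB *; lia.
    exists (Ordinal pn); last exact/SDF_codes.
    by rewrite /dimension in eB; rewrite /=; lia.
  move=> [p pB /SDF_codes SB]; split=> //.
  by rewrite /dimension -pB /= odd_double.
(* The dimension bound already gives [p < n]; the range [n.+1] is that of [coef_sum_iter_step]. *)
have OMc : OMset n k #= `I_(\sum_(p < n.+1) #|@sd_codes n k p.*2|).
  apply: (card_sqmatrix_set (dm := double) (P := @sd_codes n k)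
    (mat := fun m => @sd_mat n m.+1)).
  - exact: double_inj.
  - by move=> m; exact: sd_codes_inj.
  move=> B; rewrite /OMset /=; split.
    move=> [SB oB]; have dB := sd_dimension SB.
    have pn : (tag B)./2 < n.+1 by rewrite /dimension in dB oB *; lia.
    exists (Ordinal pn); last exact/SDF_codes.
    by rewrite /dimension in oB; rewrite /=; lia.
  move=> [p pB /SDF_codes SB]; split=> //.
  by rewrite /dimension -pB /= odd_double.
have RMc : RMset n k #= `I_(\sum_(d < n) #|@row_codes n k d|).
  apply: (card_sqmatrix_set (dm := id) (P := @row_codes n k)
    (mat := fun m => @row_mat n m.+1)).
  - by [].
  - by move=> m; exact: row_codes_inj.
  move=> B; split=> [RB|[d _ /RM_codes //]].
  have dB := row_dimension RB.
  by exists (Ordinal dB) => //; apply/RM_codes.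
split.
  rewrite (card_eql EMc) (card_eqr OMc); apply/card_eq_II/eqP.
  (* The counts are compared in [int], where the signed generating functions have their
     coefficients. *)
  by rewrite -(Num.Theory.eqr_nat int) sum_even_codes sum_odd_codes.
rewrite (card_eql OMc) (card_eqr RMc); apply/card_eq_II/eqP.
by rewrite -(Num.Theory.eqr_nat int) sum_odd_codes sum_row_codes.
Qed.
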